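(* Let $k\ge1$ and let $G$ and $G'$ be graphs without isolated vertices. Suppose that both $G$ and $G'$ have no loops, that $M_k(G)$ is a connected matroid, that $G$ has exactly one vertex $v$ such that $S(v,G)$ is not a non-separating cocircuit of $M_k(G)$, and that $M_k(G')=M_k(G)$. Then $\mathcal{S}(G)=\mathcal{S}(G')$, i.e. $G$ and $G'$ are strongly isomorphic.
   Context: Graphs are finite and may in general have loops and parallel edges. For $X\subseteq E(G)$, $G\langle X\rangle$ is the subgraph of $G$ with edge set $X$ whose vertices are the end-vertices of edges in $X$. $\Delta G=|E(G)|-|V(G)|$. $\mathcal{G}_{\bowtie}$ is the set of graphs having no isolated vertices, no leaves (vertices of degree 1, a loop contributing 2 to the degree), and no cycle components (components that are cycles; a vertex with a single loop is a cycle, and two parallel edges form a cycle). For $k\ge1$ the $k$-circular matroid $M_k(G)$ is the matroid on $E(G)$ whose circuits are the sets $C\subseteq E(G)$ with $\Delta G\langle C\rangle=k$ and $G\langle C\rangle\in\mathcal{G}_{\bowtie}$ (these are known to be the circuits of a matroid). Equality $M_k(G)=M_k(G')$ means equality of ground sets $E(G)=E(G')$ and of the families of circuits. A matroid is connected if its ground set is nonempty, it has no loops and no coloops, and every two elements belong to a common circuit. A cocircuit $K$ of a connected matroid $M$ is non-separating if the deletion $M\setminus K$ is a connected matroid. $S(x,G)$ is the set of edges of $G$ incident to $x$ (loops included), and $\mathcal{S}(G)=\{S(x,G):x\in V(G)\}$. Graphs $G=(V,E,\phi)$ and $G'=(V',E,\phi')$ with the same edge set are strongly isomorphic if there is a bijection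 $\nu:V\to V'$ such that for each edge $e$: $\phi(e)=\{x,y\}\Leftrightarrow\phi'(e)=\{\nu(x),\nu(y)\}$, where $\phi(e)$ is the set of end-vertices of $e$. *)

(* Defs.v *)
From mathcomp Require Import all_boot all_order all_algebra.

Set Implicit Arguments.
Unset Strict Implicit.
Unset Printing Implicit Defensive.

(* Finite multigraphs whose edges and vertices are drawn from ambient finite
   types [E] and [V]; [ends e] is the set of end-vertices of [e] (a singleton
   when [e] is a loop) and is meaningful only for [e \in edges G]. *)
Record mgraph (E V : finType) := MGraph {
  verts : {set V};
  edges : {set E};
  ends : E -> {set V};
  endsP : forall e, e \in edges -> (0 < #|ends e| <= 2) && (ends e \subset verts)
}.

Section Graphs.
Variables E V : finType.
Implicit Types (G H : mgraph E V) (X : {set E}) (x y : V).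

Definition star G x : {set E} := [set e in edges G | x \in ends G e].

Definition stars G : {set {set E}} := [set star G x | x in verts G].

Definition is_loop G (e : E) : bool := #|ends G e| == 1.

Definition loopless G : bool := [forall e in edges G, ~~ is_loop G e].

Definition degree G x : nat :=
  #|star G x| + #|[set e in star G x | is_loop G e]|.

Definition no_isolated G : bool := [forall x in verts G, degree G x != 0].

Definition no_leaves G : bool := [forall x in verts G, degree G x != 1].

Definition adjacent G : rel V :=
  [rel x y | [exists e in edges G, ends G e == [set x; y]]].

Definition connected_graph G : bool :=
  (verts G != set0) &&
  [forall x in verts G, forall y in verts G, connect (adjacent G) x y].

(* Degree counts a loop twice, so a single loop and a pair of parallel edges
   are cycles. *)
Definition is_cycle G : bool :=
  connected_graph G && [forall x in verts G, degree G x == 2].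

Lemma subgraph_endsP G X e : e \in edges G :&: X ->
  (0 < #|ends G e| <= 2) &&
  (ends G e \subset \bigcup_(f in edges G :&: X) ends G f).
Proof.
move=> eX; apply/andP; split; last exact: bigcup_sup.
by move: eX; rewrite inE => /andP[/endsP/andP[-> _] _].
Qed.

(* The intersection with [edges G] only makes the operation total: it is used
   for [X \subset edges G]. *)
Definition subgraph G X : mgraph E V := MGraph (@subgraph_endsP G X).

Definition component_verts G x : {set V} :=
  [set y in verts G | connect (adjacent G) x y].

Lemma component_endsP G x e :
  e \in [set e in edges G | ends G e \subset component_verts G x] ->
  (0 < #|ends G e| <= 2) && (ends G e \subset component_verts G x).
Proof. by rewrite inE => /andP[/endsP/andP[-> _] ->]. Qed.

Definition component G x : mgraph E V := MGraph (@component_endsP G x).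

Definition no_cycle_components G : bool :=
  [forall x in verts G, ~~ is_cycle (component G x)].

Definition bowtie G : bool :=
  [&& no_isolated G, no_leaves G & no_cycle_components G].

Definition Delta G : int := (#|edges G|%:Z - #|verts G|%:Z)%R.

End Graphs.

(* A matroid given by its ground set and its circuits. The circuit axioms are
   not bundled; they hold for [circular_matroid k G] below when [0 < k]. *)
Record matroid (E : finType) := Matroid {
  ground : {set E};
  circuits : {set {set E}}
}.

Section Matroids.
Variable E : finType.
Implicit Types (M : matroid E) (X B D K : {set E}) (e f : E).

Definition indep M X : bool :=
  (X \subset ground M) && [forall C in circuits M, ~~ (C \subset X)].

Definition basis M B : bool := maxset (indep M) B.

Definition cobasis M D : bool :=
  (D \subset ground M) && basis M (ground M :\: D).

(* The bases of the dual are the complements of bases, and its circuits are the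
   minimal subsets of the ground set contained in no such complement. *)
Definition dual M : matroid E :=
  Matroid (ground M)
    [set K | minset (fun X => (X \subset ground M) &&
                       [forall D, cobasis M D ==> ~~ (X \subset D)]) K].

Definition cocircuit M K : bool := K \in circuits (dual M).

Definition loop M e : bool := [set e] \in circuits M.

Definition coloop M e : bool := loop (dual M) e.

Definition delete M K : matroid E :=
  Matroid (ground M :\: K)
    [set C in circuits M | C \subset ground M :\: K].

Definition connected_matroid M : bool :=
  [&& ground M != set0,
      [forall e in ground M, ~~ loop M e && ~~ coloop M e] &
      [forall e in ground M, forall f in ground M,
         (e != f) ==>
         [exists C in circuits M, (e \in C) && (f \in C)]]].

Definition nonseparating_cocircuit M K : bool :=
  cocircuit M K && connected_matroid (delete M K).

End Matroids.

Definition circular_matroid (E V : finType) (k : nat) (G : mgraph E V) :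
    matroid E :=
  Matroid (edges G)
    [set C : {set E} | [&& C \subset edges G,
                           Delta (subgraph G C) == k%:Z%R &
                           bowtie (subgraph G C)]].

Definition strongly_isomorphic (E V V' : finType)
    (G : mgraph E V) (G' : mgraph E V') : Prop :=
  edges G = edges G' /\
  exists nu : V -> V',
    [/\ {in verts G &, injective nu},
        nu @: verts G = verts G' &
        forall e x y, e \in edges G -> x \in verts G -> y \in verts G ->
          (ends G e = [set x; y] <-> ends G' e = [set nu x; nu y])].

(* Main.v *)
Require Import Defs.
From mathcomp Require Import all_boot.
From mathcomp Require Import zify.

(* A set is independent in M_k(G) iff no subset Y of it has |Y| >= |V(Y)| + k,
   and it follows that a nonempty union X of circuits has rank |V(X)| + k - 1.
   Hence the complement of a non-separating cocircuit K misses exactly one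
   vertex, and K is the star of that vertex. All stars of G but one are thus
   stars of G', the two graphs have equally many vertices, and in a loopless
   graph the last star is determined by the others, since every edge lies in
   exactly two stars. *)

Set Implicit Arguments.
Unset Strict Implicit.
Unset Printing Implicit Defensive.

(** * Vertex spans of edge sets and degree counting *)

Section Spans.
Variables E V : finType.
Implicit Types (G H : mgraph E V) (X Y : {set E}) (x y : V).

Definition span G X : {set V} := \bigcup_(e in X) ends G e.

Lemma spanP G X x : reflect (exists2 e, e \in X & x \in ends G e) (x \in span G X).
Proof. exact: bigcupP. Qed.

Lemma span_subset G X Y : X \subset Y -> span G X \subset span G Y.
Proof.
move=> sXY; apply/subsetP=> x /spanP[e eX xe].
by apply/spanP; exists e; rewrite ?(subsetP sXY).
Qed.

Lemma spanU G X Y : span G (X :|: Y) = span G X :|: span G Y.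
Proof. exact: bigcup_setU. Qed.

Lemma edges_subgraph G X : X \subset edges G -> edges (subgraph G X) = X.
Proof. exact: setIidPr. Qed.

Lemma verts_subgraph G X : X \subset edges G -> verts (subgraph G X) = span G X.
Proof. by move=> sX; rewrite /= (setIidPr sX). Qed.

Lemma span_edges G : no_isolated G -> span G (edges G) = verts G.
Proof.
move=> isoG; apply/eqP; rewrite eqEsubset; apply/andP; split.
  by apply/bigcupsP=> e /endsP/andP[].
apply/subsetP=> x xG; have /forall_inP/(_ x xG) := isoG.
rewrite /degree => d0; have /set0Pn[e] : star G x != set0.
  apply: contra d0 => /eqP s0; rewrite s0 cards0 add0n cards_eq0.
  by apply/eqP/setP=> e; rewrite !inE.
by rewrite inE => /andP[eG xe]; apply/spanP; exists e.
Qed.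

(** Double counting of incidences; the factor [(is_loop G e).+1] lets a loop contribute 2 at its
    only end. *)
Lemma sum_degree G (A : {set V}) :
  \sum_(x in A) degree G x =
  \sum_(e in edges G) #|A :&: ends G e| * (is_loop G e).+1.
Proof.
have -> : \sum_(x in A) degree G x =
    \sum_(x in A) \sum_(e in edges G) (x \in ends G e) * (is_loop G e).+1.
  apply: eq_bigr => x _; rewrite /degree.
  have -> : [set e in star G x | is_loop G e] =
            [set e in edges G | (x \in ends G e) && is_loop G e].
    by apply/setP=> e; rewrite !inE andbA.
  rewrite -!sum1dep_card !big_mkcondr -big_split /=.
  by apply: eq_bigr => e _; case: (x \in _); case: (is_loop _ _).
rewrite exchange_big /=; apply: eq_bigr => e _.
rewrite -big_distrl /=; congr (_ * _).
rewrite -sum1_card [RHS](eq_bigl (fun x => (x \in A) && (x \in ends G e))).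
  by rewrite big_mkcondr; apply: eq_bigr => x _; case: (_ \in _).
by move=> x; rewrite inE.
Qed.

Lemma ends_weight G e :
  e \in edges G -> #|ends G e| * (is_loop G e).+1 = 2.
Proof.
by move/endsP=> /andP[+ _]; rewrite /is_loop; case: #|_| => [|[|[|]]].
Qed.

Lemma card_cycle_edges G :
  [forall x in verts G, degree G x == 2] -> #|edges G| = #|verts G|.
Proof.
move=> /forall_inP deg2.
have : \sum_(x in verts G) degree G x = #|verts G| * 2.
  by rewrite -sum_nat_const; apply: eq_bigr => x /deg2/eqP.
rewrite sum_degree (eq_bigr (fun=> 2)) => [|e eG].
  by rewrite sum_nat_const; lia.
have /andP[_ /setIidPr->] := endsP eG; exact: ends_weight.
Qed.

(** The degrees sum to at least [#|U| * 2], while by [sum_degree] only edges touching [U]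
    contribute, each at most 2. *)
Lemma card_touching_edges G X (U : {set V}) :
  X \subset edges G ->
  {in U, forall x, 2 <= degree (subgraph G X) x} ->
  #|U| <= #|[set e in X | ~~ [disjoint U & ends G e]]|.
Proof.
move=> sX deg2; set F := [set e in X | _].
have : #|U| * 2 <= \sum_(x in U) degree (subgraph G X) x.
  by rewrite -sum_nat_const; apply: leq_sum.
rewrite sum_degree edges_subgraph // => le1.
suff : \sum_(e in X) #|U :&: ends G e| * (is_loop G e).+1 <= #|F| * 2.
  by move=> le2; have := leq_trans le1 le2; rewrite leq_pmul2r.
rewrite -sum_nat_const (bigID (fun e => [disjoint U & ends G e])) /=.
rewrite big1 ?add0n => [|e /andP[_]]; last first.
  by rewrite -setI_eq0 => /eqP->; rewrite cards0.
rewrite [leqRHS](eq_bigl (fun e => (e \in X) && ~~ [disjoint U & ends G e])).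
  apply: leq_sum => e /andP[eX _].
  rewrite -(ends_weight (subsetP sX e eX)) leq_pmul2r //.
  exact/subset_leq_card/subsetIr.
by move=> e; rewrite inE.
Qed.

Lemma component_vertsP G x e :
  e \in edges G -> ~~ [disjoint component_verts G x & ends G e] ->
  ends G e \subset component_verts G x.
Proof.
move=> eG; rewrite -setI_eq0 => /set0Pn[u]; rewrite !inE => /andP[/andP[uG xu] ue].
have /andP[/andP[_ card_e] sub_e] := endsP eG.
apply/subsetP=> w we; rewrite inE (subsetP sub_e) //=.
have [<-//|ne_uw] := eqVneq u w.
apply: (connect_trans xu); apply: connect1.
apply/exists_inP; exists e => //; rewrite eq_sym eqEcard cards2 ne_uw card_e andbT.
by rewrite subUset !sub1set ue we.
Qed.

End Spans.

(** * Independence, tight sets and the rank of unions of circuits *)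

Section Circuits.
Variables (E V : finType) (k : nat) (G : mgraph E V).
Local Notation M := (circular_matroid k G).
Implicit Types (X Y Z B T C : {set E}).

Lemma circuitP C :
  C \in circuits M ->
  [/\ C \subset edges G, #|C| = #|span G C| + k & bowtie (subgraph G C)].
Proof.
rewrite inE => /and3P[sC /eqP dC bC]; split=> //.
move: dC; rewrite /Delta edges_subgraph // verts_subgraph //; lia.
Qed.

Hypothesis k_gt0 : 0 < k.

(* A minimal set [X] with [#|span G X| + k <= #|X|] is a circuit: deleting a
   leaf edge or a cycle component would preserve the inequality. *)
Lemma dense_has_circuit X :
  X \subset edges G -> #|span G X| + k <= #|X| ->
  exists2 C, C \in circuits M & C \subset X.
Proof.
move=> sX dX; have [Y /minsetP[dY minY] sYX] :=
  @minset_exists _ (fun Y => #|span G Y| + k <= #|Y|) X dX.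
exists Y => //; have sY := subset_trans sYX sX.
(* Minimality of [Y]: removing any nonempty set of edges destroys the inequality. *)
have drop Z : Z \subset Y -> Z != set0 -> ~~ (#|span G (Y :\: Z)| + k <= #|Y :\: Z|).
  move=> sZ /set0Pn[z zZ]; apply/negP=> /minY/(_ (subsetDl _ _))/setP/(_ z).
  by rewrite inE zZ (subsetP sZ).
(* Deleting one edge lowers [#|Y|] by one and cannot enlarge the span, so slack would contradict
   minimality. An edge exists because [k] is positive. *)
have cardY : #|Y| = #|span G Y| + k.
  have /card_gt0P[e eY] : 0 < #|Y| by lia.
  have := drop [set e]; rewrite sub1set -card_gt0 cards1 => /(_ eY isT).
  have := subset_leq_card (@span_subset _ _ G _ _ (subD1set Y e)).
  by have := cardsD1 e Y; rewrite eY; lia.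
rewrite inE sY /Delta edges_subgraph // verts_subgraph // cardY /=.
apply/andP; split; first by lia.
have starY x : star (subgraph G Y) x = [set e in Y | x \in ends G e].
  by rewrite /star edges_subgraph.
rewrite /bowtie /no_isolated /no_leaves /no_cycle_components verts_subgraph //.
apply/and3P; split; apply/forall_inP=> x /[dup] xY /spanP[e eY xe].
- rewrite /degree starY -lt0n addn_gt0; apply/orP; left.
  by apply/card_gt0P; exists e; rewrite inE eY.
- apply/negP; rewrite /degree starY => /eqP deg1.
  have star_gt0 : 0 < #|[set e in Y | x \in ends G e]|.
    by apply/card_gt0P; exists e; rewrite inE eY.
  have /cards1P[f starE] : #|[set e in Y | x \in ends G e]| == 1.
    by apply/eqP; lia.
  have sub : span G (Y :\ f) \subset span G Y :\ x.
    apply/subsetP=> u /spanP[g]; rewrite !inE => /andP[gf gY] ug.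
    apply/andP; split; last by apply/spanP; exists g.
    apply: contra gf => /eqP ux; have : g \in [set e in Y | x \in ends G e].
      by rewrite inE gY -ux.
    by rewrite starE inE.
  have fY : f \in Y by have := set11 f; rewrite -starE inE => /andP[].
  have := drop [set f]; rewrite sub1set -card_gt0 cards1 => /(_ fY isT).
  have := subset_leq_card sub.
  by have := cardsD1 x (span G Y); have := cardsD1 f Y; rewrite fY xY; lia.
(* A cycle component has as many edges [Z] as vertices [W], and removing [Z] removes all of [W] from
   the span. *)
- apply/negP=> /andP[_ /card_cycle_edges].
  set Z := edges _; set W := verts _ => cardZ.
  have sZ : Z \subset Y.
    by apply/subsetP=> f; rewrite !inE => /andP[/andP[]].
  have xW : x \in W by rewrite inE connect0 verts_subgraph // xY.
  have Zn0 : Z != set0.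
    by rewrite -card_gt0 cardZ; apply/card_gt0P; exists x.
  have sub : span G (Y :\: Z) \subset span G Y :\: W.
    apply/subsetP=> u /spanP[f /setDP[fY fZ] uf].
    rewrite inE; apply/andP; split; last by apply/spanP; exists f.
    apply: contra fZ => uW; rewrite inE edges_subgraph // fY /=.
    apply: (@component_vertsP _ _ (subgraph G Y)); first by rewrite edges_subgraph.
    by rewrite -setI_eq0; apply/set0Pn; exists u; rewrite inE uW.
  have sW : W \subset span G Y.
    by apply/subsetP=> u; rewrite inE verts_subgraph // => /andP[].
  have := drop Z sZ Zn0; have := subset_leq_card sub.
  rewrite !cardsD (setIidPr sZ) (setIidPr sW) cardZ.
  have := subset_leq_card sW; have := subset_leq_card sZ.
  clear -cardY cardZ Zn0; rewrite -card_gt0 in Zn0; lia.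
Qed.

Lemma indepP X :
  X \subset edges G ->
  reflect (forall Y, Y \subset X -> #|Y| < #|span G Y| + k) (indep M X).
Proof.
move=> sX; rewrite /indep /= sX /=.
apply: (iffP forall_inP) => [indX Y sYX | dX C /circuitP[_ cardC _]].
  rewrite ltnNge; apply/negP=> /(dense_has_circuit (subset_trans sYX sX))[C CM sC].
  by have := indX C CM; rewrite (subset_trans sC).
by apply/negP=> /dX; rewrite cardC ltnn.
Qed.

Lemma indep_card_lt B Y : indep M B -> Y \subset B -> #|Y| < #|span G Y| + k.
Proof. by move=> /[dup] /andP[sB _] /(indepP sB); apply. Qed.

(** Equality in the bound of [indep_card_lt]: inside an independent set, tight sets are as large as
    their span allows. *)
Definition tight T : bool := #|T|.+1 == #|span G T| + k.

(** Uncrossing: the size of the span is submodular and the intersection obeys the independence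
    bound, so the union must reach its own bound. *)
Lemma tightU B T1 T2 :
  indep M B -> T1 \subset B -> T2 \subset B -> tight T1 -> tight T2 ->
  tight (T1 :|: T2).
Proof.
move=> indB s1 s2 /eqP t1 /eqP t2; rewrite /tight.
have sU : T1 :|: T2 \subset B by rewrite subUset s1.
have := indep_card_lt indB sU.
have := indep_card_lt indB (subset_trans (subsetIl T1 T2) s1).
have : #|span G (T1 :&: T2)| <= #|span G T1 :&: span G T2|.
  by apply: subset_leq_card; rewrite subsetI !span_subset ?subsetIl ?subsetIr.
rewrite spanU.
have := cardsUI T1 T2; have := cardsUI (span G T1) (span G T2); lia.
Qed.

(* Let [T] be the largest tight subset of [B]. Every edge of [X] outside [B]
   has its ends in [span G T], so the edges of [X] that touch the remaining
   vertices all lie in [B :\: T]; as these vertices have degree at least two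
   there are at least as many such edges as vertices. *)
Lemma card_maximal_indep X B :
  X \subset edges G -> X != set0 ->
  {in X, forall e, exists C, [/\ C \in circuits M, e \in C & C \subset X]} ->
  maxset (fun A => (A \subset X) && indep M A) B ->
  #|B|.+1 = #|span G X| + k.
Proof.
move=> sX /set0Pn[e0 e0X] covX /maxsetP[/andP[sBX indB] maxB].
(* Adding [e] to [B] creates a circuit [C] through [e]. Counting shows that [C :\ e] is tight and
   has the same span as [C], which contains the ends of [e]. *)
have tight_of e : e \in X -> e \notin B ->
    exists T, [/\ T \subset B, tight T & ends G e \subset span G T].
  move=> eX eB; have seB : e |: B \subset X by rewrite subUset sub1set eX.
  have : ~~ indep M (e |: B).
    apply: contra eB => indeB; rewrite -(maxB (e |: B)) ?setU11 ?subsetUr //.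
    by rewrite seB.
  rewrite /indep (subset_trans seB sX) /= negb_forall_in.
  case/exists_inP=> C /circuitP[sC cardC _]; rewrite negbK => sCeB.
  have sCB : C :\ e \subset B by rewrite subDset.
  have eC : e \in C.
    apply/negPn/negP=> eC; have CE : C :\ e = C.
      by apply/setDidPl; rewrite disjoint_sym disjoints1.
    by have := indep_card_lt indB sCB; rewrite CE cardC ltnn.
  exists (C :\ e); split=> //.
    have := indep_card_lt indB sCB.
    have := subset_leq_card (@span_subset _ _ G _ _ (subD1set C e)).
    by rewrite /tight; have := cardsD1 e C; rewrite eC; clear -cardC; lia.
  have /eqP-> : span G (C :\ e) == span G C.
    rewrite eqEcard span_subset ?subD1set //=.
    have := indep_card_lt indB sCB.
    by have := cardsD1 e C; rewrite eC; clear -cardC; lia.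
  by apply/subsetP=> x xe; apply/spanP; exists e.
(* [X] contains a circuit, so [B] is not all of [X]; this supplies a first tight set. *)
have [f fX fB] : exists2 f, f \in X & f \notin B.
  have [C [/circuitP[_ cardC _] _ sCX]] := covX e0 e0X.
  apply/subsetPn/negP=> sXB.
  by have := indep_card_lt indB (subset_trans sCX sXB); rewrite cardC ltnn.
have [T0 [sT0 tT0 _]] := tight_of f fX fB.
have [T /maxsetP[/andP[sTB tT] maxT] _] :=
  @maxset_exists _ (fun T => (T \subset B) && tight T) T0 (introT andP (conj sT0 tT0)).
have tight_sub T1 : T1 \subset B -> tight T1 -> T1 \subset T.
  move=> s1 t1; rewrite -(maxT (T :|: T1)) ?subsetUl ?subsetUr //.
  by rewrite subUset sTB s1 (tightU indB).
pose U := span G X :\: span G T.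
(* Each vertex of [X] lies on a circuit inside [X], where it is neither isolated nor a leaf. *)
have deg2 : {in U, forall x, 2 <= degree (subgraph G X) x}.
  move=> x /setDP[/spanP[e eX xe] _].
  have [C [/circuitP[sC _ /and3P[iC lC _]] eC sCX]] := covX e eX.
  have xC : x \in verts (subgraph G C).
    by rewrite verts_subgraph //; apply/spanP; exists e.
  have : 2 <= degree (subgraph G C) x.
    move/forall_inP: iC => /(_ x xC); move/forall_inP: lC => /(_ x xC).
    by case: degree => [|[|]].
  move/leq_trans; apply; apply: leq_add; apply: subset_leq_card;
    apply/subsetP=> g; rewrite !inE.
    by case/andP=> /andP[-> /(subsetP sCX)->] ->.
  by case/andP=> /andP[/andP[-> /(subsetP sCX)->] ->] loopg; exact: loopg.
have leUF := card_touching_edges sX deg2.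
set F := [set e in X | _] in leUF.
have sFB : F \subset B :\: T.
  apply/subsetP=> e; rewrite inE => /andP[eX].
  rewrite -setI_eq0 => /set0Pn[x /setIP[/setDP[_ xT] xe]].
  rewrite inE; apply/andP; split.
    by apply: contra xT => eT; apply/spanP; exists e.
  apply/negPn/negP=> /(tight_of e eX)[T1 [s1 t1 /subsetP/(_ x xe) xT1]].
  by rewrite (subsetP (span_subset G (tight_sub T1 s1 t1))) in xT.
(* Lower bound: [#|B| >= #|T| + #|U|], and tightness of [T] turns this into [#|span G X| + k - 1].
   Independence of [B] gives the upper bound. *)
have := subset_leq_card sFB; rewrite cardsD (setIidPr sTB).
have := indep_card_lt indB (subxx B).
have := subset_leq_card (span_subset G sBX).
have sTX := span_subset G (subset_trans sTB sBX).
move: leUF; rewrite cardsD (setIidPr sTX) => leUF.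
have := subset_leq_card sTX; have := subset_leq_card sTB.
move/eqP: tT; clear -leUF; lia.
Qed.

End Circuits.

(** * Cocircuits as minimal sets meeting every basis *)

Section Cocircuits.
Variable E : finType.
Implicit Types (M : matroid E) (X B K : {set E}) (e : E).

Definition meets_bases M X : bool :=
  (X \subset ground M) && [forall B, basis M B ==> ~~ [disjoint X & B]].

Lemma basis_subset M B : basis M B -> B \subset ground M.
Proof. by case/maxsetP=> /andP[]. Qed.

(** Complementation in the ground set turns being contained in a cobasis into being disjoint from a
    basis. *)
Lemma cocircuit_minset M K : cocircuit M K = minset (meets_bases M) K.
Proof.
rewrite /cocircuit inE; apply: minset_eq => X; rewrite /meets_bases.
have [sX|//] := boolP (X \subset ground M).
apply/forallP/forallP=> /= meet B; apply/implyP=> bB.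
  have sB := basis_subset bB.
  have /implyP := meet (ground M :\: B); rewrite /cobasis subsetDl setDDr setDv set0U.
  by rewrite (setIidPr sB) subsetD sX; apply.
case/andP: bB => sB bB; have /implyP/(_ bB) := meet (ground M :\: B).
apply: contra => sXB; rewrite -setI_eq0; apply/eqP/setP=> e; rewrite !inE.
by case: (boolP (e \in X)) => // /(subsetP sXB) ->.
Qed.

(** An element on no circuit can be added to every independent set, so it lies in all bases and is a
    coloop. Independence of [set0] provides a basis, so the empty set does not meet all bases. *)
Lemma noncoloop_in_circuit M e :
  indep M set0 -> e \in ground M -> ~~ coloop M e ->
  exists2 C, C \in circuits M & e \in C.
Proof.
move=> ind0 eM; rewrite /coloop /loop -/(cocircuit M _) cocircuit_minset => nco.
apply/exists_inP; apply: contraNT nco; rewrite negb_exists_in => /forall_inP eC.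
apply/minsetP; split=> [|X].
  rewrite /meets_bases sub1set eM; apply/forallP=> B; apply/implyP.
  case/maxsetP=> /andP[sB /forall_inP indB] maxB; rewrite disjoints1 negbK.
  rewrite -(maxB (e |: B)) ?setU11 ?subsetUr // /indep subUset sub1set eM sB /=.
  apply/forall_inP=> C CM; apply: contra (indB C CM) => sC.
  apply/subsetP=> f fC; have := subsetP sC f fC.
  by rewrite !inE => /orP[/eqP fe|//]; have := eC C CM; rewrite -fe fC.
rewrite subset1 => /andP[_ /forallP meet] /orP[/eqP//|/eqP X0].
have [B bB _] := maxset_exists ind0.
by have /implyP/(_ bB) := meet B; rewrite X0 -setI_eq0 set0I eqxx.
Qed.

End Cocircuits.

(** * Stars of vertices and non-separating cocircuits *)

Section Stars.
Variables (E V : finType) (k : nat) (G : mgraph E V).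
Hypotheses (k_gt0 : 0 < k) (isoG : no_isolated G).
Hypothesis connM : connected_matroid (circular_matroid k G).
Local Notation M := (circular_matroid k G).
Implicit Types (X Y B K : {set E}).

(** The pairwise clause of connectedness says nothing about a one-element ground set; the absence of
    coloops gives a circuit through each element in all cases. *)
Lemma connected_cover K :
  connected_matroid (delete M K) ->
  {in edges G :\: K, forall e,
    exists C, [/\ C \in circuits M, e \in C & C \subset edges G :\: K]}.
Proof.
case/and3P=> _ /forall_inP noloop _ e eH.
have ind0 : indep (delete M K) set0.
  rewrite /indep sub0set; apply/forall_inP=> C; rewrite inE => /andP[CM _].
  rewrite subset0; apply: contraL CM => /eqP->; apply/negP=> /circuitP[_ + _].
  rewrite cards0; lia.
have /andP[_ nco] := noloop e eH.
have [C] := noncoloop_in_circuit ind0 eH nco.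
by rewrite inE => /andP[CM sC] eC; exists C.
Qed.

Lemma delete_set0 : delete M set0 = M.
Proof.
rewrite /delete /= setD0; congr Matroid; apply/setP=> C.
by rewrite !inE andb_idr // => /and3P[].
Qed.

Lemma card_basis B : basis M B -> #|B|.+1 = #|verts G| + k.
Proof.
move=> bB; rewrite -(span_edges isoG); apply: (card_maximal_indep k_gt0) => //.
- by case/and3P: connM.
- move: connM; rewrite -{1}delete_set0 => /connected_cover.
  by rewrite setD0.
- rewrite (maxset_eq (P2 := indep M)) // => A.
  by apply/andb_idl=> /andP[].
Qed.

Lemma basis_exists X : indep M X -> exists2 B, basis M B & X \subset B.
Proof. by case/maxset_exists=> B; exists B. Qed.

Lemma span_star_setC X (A : {set V}) :
  X \subset edges G -> {in A, forall x, [disjoint X & star G x]} ->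
  span G X \subset verts G :\: A.
Proof.
move=> sX dis; apply/subsetP=> u /spanP[e eX ue]; rewrite inE.
have eG := subsetP sX e eX; apply/andP; split.
  apply/negP=> /dis; rewrite -setI_eq0 => /eqP/setP/(_ e).
  by rewrite !inE eX eG ue.
by have /andP[_ /subsetP->] := endsP eG.
Qed.

Lemma basis_indep B : basis M B -> indep M B.
Proof. by case/maxsetP. Qed.

(** A basis avoiding the star would span at most [#|verts G| - 1] vertices, too few for its size. *)
Lemma star_meets_bases x : x \in verts G -> meets_bases M (star G x).
Proof.
move=> xG; apply/andP; split.
  by apply/subsetP=> e; rewrite inE => /andP[].
apply/forallP=> B; apply/implyP=> bB; apply/negP=> dis.
have sB : span G B \subset verts G :\: [set x].
  apply: span_star_setC; first exact: basis_subset bB.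
  by move=> y /set1P->; rewrite disjoint_sym.
have := subset_leq_card sB; have := cardsD1 x (verts G); rewrite xG.
have := indep_card_lt k_gt0 (basis_indep bB) (subxx B).
have := card_basis bB; lia.
Qed.

(* [H = E :\: K] has smaller rank than [M]. As both restrictions are connected,
   their ranks are [#|span G H| + k - 1] and [#|verts G| + k - 1], so [H]
   misses a vertex [x], and [star G x] is contained in [K]. *)
Lemma nonseparating_is_star K :
  nonseparating_cocircuit M K -> K \in stars G.
Proof.
rewrite /nonseparating_cocircuit cocircuit_minset.
move=> /andP[/minsetP[/andP[sK /forallP meetK] minK] connH].
have sH : edges G :\: K \subset edges G by exact: subsetDl.
have Hn0 : edges G :\: K != set0 by case/and3P: connH.
have ind0 : (set0 \subset edges G :\: K) && indep M set0.
  rewrite sub0set; apply/(indepP k_gt0 (sub0set _)) => Y.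
  by rewrite subset0 => /eqP->; rewrite cards0; lia.
have [B maxB _] :=
  @maxset_exists _ (fun A => (A \subset edges G :\: K) && indep M A) set0 ind0.
have cardB := card_maximal_indep k_gt0 sH Hn0 (connected_cover connH) maxB.
have /maxsetP[/andP[sB indB] _] := maxB.
have [B1 bB1 sBB1] := basis_exists indB.
(* Otherwise the basis [B1] would be [B], which avoids [K], although [K] meets every basis. *)
have ltB : #|B| < #|B1|.
  apply: proper_card; rewrite properE sBB1; apply/negP=> sB1.
  have /implyP/(_ bB1)/negP := meetK B1; apply.
  rewrite disjoint_sym; apply: disjointWl (subset_trans sB1 sB) _.
  by rewrite -setI_eq0 setIDAC setDIl setDv setI0.
have lt_span : #|span G (edges G :\: K)| < #|verts G|.
  by rewrite -(ltn_add2r k) -cardB -(card_basis bB1) ltnS.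
have /subsetPn[x xG xH] : ~~ (verts G \subset span G (edges G :\: K)).
  by apply/negP=> /subset_leq_card; rewrite leqNgt lt_span.
apply/imsetP; exists x => //; apply/esym/minK; first exact: star_meets_bases.
apply/subsetP=> e; rewrite inE => /andP[eG xe]; apply: contraNT xH => eK.
by apply/spanP; exists e; rewrite // inE eK.
Qed.

(** By minimality some basis [B] meets the star at most in a chosen edge [e]. If the stars
    coincided, [B :\ e] would miss both [x] and [y], and its size would exceed the independence
    bound. *)
Lemma cocircuit_star_inj x y :
  x \in verts G -> y \in verts G -> cocircuit M (star G x) ->
  star G x = star G y -> x = y.
Proof.
move=> xG yG; rewrite cocircuit_minset => /minsetP[_ minK] eqS.
apply/eqP/negPn/negP=> ne_xy.
have /set0Pn[e eS] : star G x != set0.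
  have := xG; rewrite -(span_edges isoG) => /spanP[e eG xe].
  by apply/set0Pn; exists e; rewrite inE eG.
have sS : star G x \subset edges G by apply/subsetP=> f; rewrite inE => /andP[].
have : ~~ meets_bases M (star G x :\ e).
  by apply/negP=> /minK/(_ (subD1set _ _))/setP/(_ e); rewrite in_setD1 eqxx eS.
rewrite /meets_bases (subset_trans (subD1set _ _) sS) /= negb_forall.
case/existsP=> B; rewrite negb_imply negbK => /andP[bB dis].
have sB := basis_subset bB; have sBe := subset_trans (subD1set B e) sB.
have disS : [disjoint B :\ e & star G x].
  move: dis; rewrite -!setI_eq0 => /eqP/setP dis; apply/eqP/setP=> f.
  have := dis f; rewrite !in_set0 !in_setI !in_setD1.
  by case: (f == e); case: (f \in B); case: (f \in star G x).
have sub : span G (B :\ e) \subset verts G :\: [set x; y].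
  by apply: span_star_setC => // z /set2P[]->; rewrite -?eqS.
have sxy : [set x; y] \subset verts G by rewrite subUset !sub1set xG.
have := subset_leq_card sub; have := subset_leq_card sxy.
rewrite cardsD (setIidPr sxy) cards2 ne_xy.
have := indep_card_lt k_gt0 (basis_indep bB) (subD1set B e).
have := cardsD1 e B; have := card_basis bB; clear.
by case: (e \in B) => /=; lia.
Qed.

End Stars.

(** * Matching the stars of the two graphs *)

Lemma card_stars_containing (E V : finType) (G : mgraph E V) e :
  loopless G -> e \in edges G -> #|[set x in verts G | e \in star G x]| = 2.
Proof.
move=> /forall_inP/(_ e) loopG eG; have /andP[cardE sE] := endsP eG.
have -> : [set x in verts G | e \in star G x] = ends G e.
  apply/setP=> x; rewrite !inE eG /=; apply/andb_idl; exact: (subsetP sE).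
by move: cardE (loopG eG); rewrite /is_loop; case: #|_| => [|[|[|]]].
Qed.

(** Stars record all incidences, so a vertex bijection preserving stars carries the ends of each
    edge to its ends in [G']. *)
Lemma star_injection_strong (E V V' : finType)
    (G : mgraph E V) (G' : mgraph E V') (nu : V -> V') :
  edges G = edges G' -> {in verts G &, injective nu} ->
  nu @: verts G = verts G' ->
  {in verts G, forall x, star G' (nu x) = star G x} ->
  stars G = stars G' /\ strongly_isomorphic G G'.
Proof.
move=> eqE injnu imnu starnu; split.
  rewrite /stars -imnu -imset_comp; apply: eq_in_imset => x xG /=.
  by rewrite starnu.
split=> //; exists nu; split=> // e x y eG xG yG.
have memE u : u \in verts G -> (nu u \in ends G' e) = (u \in ends G e).
  by move/starnu=> /setP/(_ e); rewrite !inE -eqE eG.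
have eG' : e \in edges G' by rewrite -eqE.
have /andP[_ /subsetP sE] := endsP eG; have /andP[_ /subsetP sE'] := endsP eG'.
split=> eqEnds.
  apply/setP=> u'; apply/idP/idP=> [u'E|].
    have := sE' _ u'E; rewrite -imnu => /imsetP[u uG u'E1].
    by move: u'E; rewrite u'E1 memE // eqEnds !inE => /orP[]/eqP->; rewrite eqxx ?orbT.
  by case/set2P=> ->; rewrite memE // eqEnds !inE eqxx ?orbT.
apply/setP=> u; apply/idP/idP=> [uE|].
  have uG := sE _ uE; move: uE; rewrite -memE // eqEnds !inE.
  by case/orP=> /eqP/injnu-> //; rewrite eqxx ?orbT.
by case/set2P=> ->; rewrite -memE // eqEnds !inE eqxx ?orbT.
Qed.

Theorem theorem6p1 (k : nat) (E V V' : finType)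
    (G : mgraph E V) (G' : mgraph E V')
    (k_gt0 : 0 < k)
    (isoG : no_isolated G) (isoG' : no_isolated G')
    (loopG : loopless G) (loopG' : loopless G')
    (connM : connected_matroid (circular_matroid k G))
    (uniq_v : exists! v : V, v \in verts G /\
       ~~ nonseparating_cocircuit (circular_matroid k G) (star G v))
    (eqM : circular_matroid k G' = circular_matroid k G) :
  stars G = stars G' /\ strongly_isomorphic G G'.
Proof.
have [v [[vG _] uniqv]] := uniq_v.
have eqE : edges G' = edges G by case: eqM.
have nsep x : x \in verts G :\ v ->
    nonseparating_cocircuit (circular_matroid k G) (star G x).
  case/setD1P=> xv xG; apply/negPn/negP=> nx.
  by move: xv; rewrite (uniqv x (conj xG nx)) eqxx.
have connM' : connected_matroid (circular_matroid k G') by rewrite eqM.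
(* A common basis has size [#|verts G| + k - 1] and likewise for [G']. *)
have cardV : #|verts G'| = #|verts G|.
  have [B bB _] : exists2 B, basis (circular_matroid k G) B & set0 \subset B.
    apply: basis_exists; apply/(indepP k_gt0 (sub0set _)) => Y.
    by rewrite subset0 => /eqP->; rewrite cards0; lia.
  have := card_basis k_gt0 isoG connM bB.
  by move: bB; rewrite -eqM => /(card_basis k_gt0 isoG' connM'); lia.
have match_star x : x \in verts G :\ v ->
    exists2 x', x' \in verts G' & star G' x' = star G x.
  move/nsep; rewrite -eqM => /(nonseparating_is_star k_gt0 isoG' connM').
  by case/imsetP=> x' x'G' ->; exists x'.
pose S := verts G :\ v.
have inj_star : {in S &, injective (star G)}.
  move=> x y xS yS; apply: (cocircuit_star_inj k_gt0 isoG connM).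
  - by case/setD1P: xS. - by case/setD1P: yS.
  - by case/andP: (nsep x xS).
have /card_gt0P[v0 _] : 0 < #|verts G'|.
  by rewrite cardV; apply/card_gt0P; exists v.
(* The default [v0] is never taken on [S], where [match_star] guarantees a match. *)
pose f x := odflt v0 [pick x' in verts G' | star G' x' == star G x].
have fP x : x \in S -> f x \in verts G' /\ star G' (f x) = star G x.
  move=> /match_star[x' x'G' eqS]; rewrite /f; case: pickP => [u /andP[uG /eqP]//|].
  by move/(_ x'); rewrite /= x'G' eqS eqxx.
have injf : {in S &, injective f}.
  by move=> x y xS yS eqf; apply: inj_star; rewrite // -(fP x xS).2 -(fP y yS).2 eqf.
have sfS : f @: S \subset verts G'.
  by apply/subsetP=> _ /imsetP[x /fP[? _] ->].
have cardS : #|verts G| = #|S|.+1 by rewrite (cardsD1 v) vG.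
(* As [f] is injective on [S], it misses exactly one vertex of [G'], the candidate partner of
   [v]. *)
have /cards1P[v' v'E] : #|verts G' :\: f @: S| == 1.
  by rewrite cardsD (setIidPr sfS) card_in_imset // cardV cardS subSnn.
have vertsE' : verts G' = v' |: f @: S.
  by rewrite -v'E setUC -{1}(setID (verts G') (f @: S)) (setIidPr sfS).
have v'S : v' \notin f @: S.
  by have := set11 v'; rewrite -v'E => /setDP[].
have v'G' : v' \in verts G' by rewrite vertsE' setU11.
(* Every edge lies in exactly two stars, so the stars of [S] determine the
   remaining one. *)
have star_v : star G' v' = star G v.
  apply/setP=> e; have [eG|eG] := boolP (e \in edges G); last first.
    by rewrite !inE eqE (negPf eG).
  have eG' : e \in edges G' by rewrite eqE.
  have := card_stars_containing loopG' eG'; have := card_stars_containing loopG eG.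
  (* Both counts are 2. With [v] and [v'] removed, the rest correspond under [f], so [e] lies in
     both remaining stars or in neither. *)
  rewrite (cardsD1 v) [in X in _ -> X](cardsD1 v').
  have -> : [set x in verts G' | e \in star G' x] :\ v' =
            f @: ([set x in verts G | e \in star G x] :\ v).
    apply/setP=> u; apply/idP/imsetP=> [|[x]].
      rewrite in_setD1 in_set vertsE' in_setU1 => /and3P[uv' + eu].
      rewrite (negPf uv') => /imsetP[x xS uE]; exists x => //.
      case/setD1P: (xS) => xv xG.
      by rewrite in_setD1 in_set xv xG -(fP x xS).2 -uE.
    rewrite in_setD1 in_set => /and3P[xv xG ex] ->.
    have xS : x \in S by rewrite in_setD1 xv.
    rewrite in_setD1 in_set (fP x xS).1 (fP x xS).2 ex !andbT.
    by apply: contra v'S => /eqP<-; apply: imset_f.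
  rewrite card_in_imset; last first.
    move=> x y; rewrite !in_setD1 !in_set => /and3P[xv xG _] /and3P[yv yG _].
    by apply: injf; rewrite in_setD1 ?xv ?yv.
  rewrite !in_set vG v'G' /= eqE eG /=.
  by clear; case: (v \in _); case: (v' \in _); lia.
apply: (@star_injection_strong _ _ _ _ _ (fun x => if x == v then v' else f x)).
- by [].
- move=> x y xG yG /=.
  have [->|xv] := eqVneq x v; have [->|yv] := eqVneq y v => //.
  + by move=> v'y; case/negP: v'S; rewrite v'y imset_f // in_setD1 yv.
  + by move=> v'x; case/negP: v'S; rewrite -v'x imset_f // in_setD1 xv.
  + by apply: injf; rewrite in_setD1 ?xv ?yv.
- rewrite vertsE' -(setD1K vG) imsetU1 eqxx; congr (_ |: _).
  by apply: eq_in_imset => x /setD1P[/negPf-> _].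
- move=> x xG; have [->//|xv] := eqVneq x v.
  by apply: (fP x _).2; rewrite in_setD1 xv.
Qed.
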